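(* If $(\mathcal{A},\mathcal{B})$ is a recovering pair on an $n$ element ground set, then $|\mathcal{A}||\mathcal{B}| \leq (1+\sqrt{2})^n$.
   Context: A pair $(\mathcal{A},\mathcal{B})$ of set systems (families of subsets) on an $n$ element ground set is called a recovering pair if for every $A,A' \in \mathcal{A}$ and $B,B' \in \mathcal{B}$: ($A \setminus B = A' \setminus B'$ implies $A=A'$) and ($B \setminus A = B' \setminus A'$ implies $B=B'$). *)

(* Defs.v *)
From HB Require Import structures.
From mathcomp Require Import all_boot all_order all_algebra.

Set Implicit Arguments.
Unset Strict Implicit.
Unset Printing Implicit Defensive.

Definition recovering_pair (T : finType) (A B : {set {set T}}) : Prop :=
  forall X X' Y Y' : {set T},
    X \in A -> X' \in A -> Y \in B -> Y' \in B ->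
    (X :\: Y = X' :\: Y' -> X = X') /\ (Y :\: X = Y' :\: X' -> Y = Y').

(* Main.v *)
(** For fixed Y in B the map X |-> X \ Y is injective on A, and for fixed X in
    A the map Y |-> Y \ X is injective on B.  Draw X and Y uniformly and
    independently, and let x_i and y_i be the probabilities that i lies in X
    and in Y.  Injectivity for each fixed Y, averaged over Y, bounds ln |A| by
    the sum over i of (1 - y_i) times the cross entropy of Bernoulli(x_i)
    relative to any Bernoulli(p_i); symmetrically, ln |B| is at most the sum of
    (1 - x_i) times the cross entropy of Bernoulli(y_i) relative to any
    Bernoulli(q_i).  For every (x_i, y_i) in the unit square, p_i and q_i can
    be chosen so that the two i-th terms add up to at most ln (1 + sqrt 2). *)

Require Import Defs.
From HB Require Import structures.
From mathcomp Require Import all_boot all_order all_algebra.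
From mathcomp Require Import reals.
From mathcomp Require Import boolp exp ring lra.

Set Implicit Arguments.
Unset Strict Implicit.
Unset Printing Implicit Defensive.

Import Order.TTheory GRing.Theory Num.Theory.
Local Open Scope ring_scope.

Definition bernoulli_weight (R : realType) (p : R) (b : bool) : R :=
  if b then p else 1 - p.

Definition freq (R : realType) (T : finType) (A : {set {set T}}) (i : T) : R :=
  #|[set X in A | i \in X]|%:R / #|A|%:R.

Lemma bernoulli_weight_gt0 (R : realType) (p : R) (b : bool) :
  0 < p < 1 -> 0 < bernoulli_weight p b.
Proof.
by rewrite /bernoulli_weight; case: b => /andP[p0 p1]; rewrite ?subr_gt0.
Qed.

Lemma freq_ge0_le1 (R : realType) (T : finType) (A : {set {set T}}) (i : T) :
  0 <= freq R A i <= 1.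
Proof.
rewrite divr_ge0 ?ler0n //=.
have [->|A0] := eqVneq A set0; first by rewrite /freq cards0 invr0 mulr0.
rewrite ler_pdivrMr ?ltr0n ?card_gt0 // mul1r ler_nat subset_leq_card //.
by apply/subsetP => X; rewrite inE => /andP[].
Qed.

Lemma sum_freq (R : realType) (T : finType) (A : {set {set T}}) (i : T)
    (u v : R) :
  \sum_(X in A) (if i \in X then u else v)
    = #|A|%:R * (freq R A i * u + (1 - freq R A i) * v).
Proof.
have [->|A0] := eqVneq A set0; first by rewrite big_set0 cards0 mul0r.
have nz : #|A|%:R != 0 :> R by rewrite pnatr_eq0 -lt0n card_gt0.
transitivity (\sum_(X in A) (v + (if i \in X then u - v else 0))).
  by apply: eq_bigr => X _; case: ifP => _; ring.
rewrite big_split /= sumr_const -big_mkcondr /=.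
rewrite (eq_bigl [in [set X in A | i \in X]]); last by move=> X; rewrite !inE.
rewrite sumr_const /freq -[v *+ _]mulr_natr -[(u - v) *+ _]mulr_natr.
by field.
Qed.

(** The products are the probabilities of a random subset of [S] that contains each [i]
    independently with probability [p i]. *)
Lemma sum_subset_weights (R : realType) (T : finType) (S : {set T})
    (p : T -> R) (F : {set {set T}}) :
  (forall i, 0 < p i < 1) -> (forall X, X \in F -> X \subset S) ->
  \sum_(X in F) \prod_(i in S) bernoulli_weight (p i) (i \in X) <= 1.
Proof.
move=> p01 FS.
(* Extending the product to all of [T] with weights 0 and 1 outside [S] gives mass zero to sets not
   inside [S], so the total can be expanded over all subsets. *)
pose a i := if i \in S then p i else 0.
pose b i := if i \in S then 1 - p i else 1.
have ge0 (X : {set T}) : 0 <= \prod_i (if i \in X then a i else b i).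
  apply: prodr_ge0 => i _; case/andP: (p01 i) => /ltW p0 /ltW p1.
  by rewrite /a /b; case: ifP => _; case: ifP => _; rewrite ?subr_ge0.
have -> : \sum_(X in F) \prod_(i in S) bernoulli_weight (p i) (i \in X)
    = \sum_(X in F) \prod_i (if i \in X then a i else b i).
  apply: eq_bigr => X /FS /subsetP XS; rewrite [RHS](bigID (mem S)) /=.
  rewrite [X in _ * X]big1 ?mulr1; last first.
    move=> i iS; rewrite (contraNF (XS i)) // /b.
    by rewrite (negbTE iS).
  by apply: eq_bigr => i iS; rewrite /a /b iS.
have total : \sum_(X : {set T}) \prod_i (if i \in X then a i else b i) = 1.
  rewrite -bigA_distr big1 // => i _; rewrite /a /b.
  by case: ifP => _ /=; ring.
by rewrite -[leRHS]total [leRHS](bigID (mem F)) /= lerDl sumr_ge0.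
Qed.

Lemma ln_prod (R : realType) (I : finType) (P : pred I) (f : I -> R) :
  (forall i, P i -> 0 < f i) ->
  ln (\prod_(i | P i) f i) = \sum_(i | P i) ln (f i).
Proof.
move=> f0.
suff [_ ->] : 0 < \prod_(i | P i) f i /\
    ln (\prod_(i | P i) f i) = \sum_(i | P i) ln (f i) by [].
elim/big_rec2: _ => [|i s q Pi [q0 <-]]; first by rewrite ln1.
by rewrite mulr_gt0 ?f0 // lnM ?posrE ?f0.
Qed.

(** Gibbs' inequality for the uniform distribution on [A]: sum [ln t <= t - 1] at [t = #|A| * f x]
    over [A]. *)
Lemma ln_card_le_sum (R : realType) (I : finType) (A : {set I}) (f : I -> R) :
  A != set0 -> (forall x, 0 < f x) -> \sum_(x in A) f x <= 1 ->
  #|A|%:R * ln #|A|%:R <= \sum_(x in A) - ln (f x).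
Proof.
move=> A0 f0 f1; have n0 : 0 < #|A|%:R :> R by rewrite ltr0n card_gt0.
have le_term x : ln #|A|%:R <= - ln (f x) + (#|A|%:R * f x - 1).
  rewrite -lerBlDl opprK -lnM ?posrE //.
  have /le_ln1Dx : -1 < #|A|%:R * f x - 1 :> R.
    by have := mulr_gt0 n0 (f0 x); lra.
  by rewrite addrC subrK.
rewrite mulr_natl -sumr_const.
apply: (le_trans (ler_sum _ (fun x _ => le_term x))).
rewrite big_split /= gerDl sumrB -mulr_sumr sumr_const subr_le0.
by rewrite ler_piMr // ltW.
Qed.

(** For fixed [Y], the sets [X :\: Y] are distinct subsets of the complement of [Y], so Gibbs'
    inequality applies to their Bernoulli weights. Averaging over [X] produces [freq R A i];
    averaging over [Y] turns the condition that [i] lies outside [Y] into the factor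
    [1 - freq R B i]. *)
Lemma ln_card_le_cross_entropy (R : realType) (T : finType)
    (A B : {set {set T}}) (p : T -> R) :
  A != set0 -> B != set0 ->
  (forall Y, Y \in B -> {in A &, injective (fun X => X :\: Y)}) ->
  (forall i, 0 < p i < 1) ->
  ln #|A|%:R <= \sum_i (1 - freq R B i) *
    - (freq R A i * ln (p i) + (1 - freq R A i) * ln (1 - p i)).
Proof.
move=> A0 B0 inj p01.
have nA : 0 < #|A|%:R :> R by rewrite ltr0n card_gt0.
have nB : 0 < #|B|%:R :> R by rewrite ltr0n card_gt0.
pose c i := - (freq R A i * ln (p i) + (1 - freq R A i) * ln (1 - p i)).
have le_fixed Y : Y \in B -> ln #|A|%:R <= \sum_i (if i \in Y then 0 else c i).
  move=> YB.
  pose f (X : {set T}) :=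
    \prod_(i in ~: Y) bernoulli_weight (p i) (i \in X).
  have f0 X : 0 < f X.
    by apply: prodr_gt0 => i _; apply: bernoulli_weight_gt0.
  have f1 : \sum_(X in A) f X <= 1.
    (* [f] only looks at points outside [Y], where [X] and [X :\: Y] agree. *)
    have -> : \sum_(X in A) f X = \sum_(X in [set X :\: Y | X in A]) f X.
      rewrite (big_imset _ (inj Y YB)) /=; apply: eq_bigr => X _.
      by apply: eq_bigr => i; rewrite !inE => ->.
    apply: sum_subset_weights => // _ /imsetP[X _ ->].
    by rewrite setDE subsetIr.
  rewrite -(ler_pM2l nA); apply: (le_trans (ln_card_le_sum A0 f0 f1)).
  have lnf X : - ln (f X) = \sum_(i in ~: Y)
      (if i \in X then - ln (p i) else - ln (1 - p i)).
    rewrite /f ln_prod => [|i _]; last exact: bernoulli_weight_gt0.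
    by rewrite -sumrN; apply: eq_bigr => i _; rewrite /bernoulli_weight; case: ifP.
  under eq_bigr do rewrite lnf.
  rewrite exchange_big /= mulr_sumr [leRHS](bigID (mem Y)) /=.
  rewrite [X in _ <= X + _]big1 ?add0r; last by move=> i ->; rewrite mulr0.
  rewrite le_eqVlt; apply/orP; left; apply/eqP.
  apply: eq_big => [i|i]; rewrite inE // => /negbTE ->.
  by rewrite sum_freq /c; ring.
rewrite -(ler_pM2l nB) mulr_natl -sumr_const.
apply: (le_trans (ler_sum _ le_fixed)).
rewrite exchange_big /= mulr_sumr; apply: ler_sum => i _.
by rewrite sum_freq mulr0 add0r.
Qed.

(* For fixed weights the left-hand side is affine in x and in y, so it suffices
   to check corners: one pair of weights works on [0, 1/3]^2, another one on
   [0, 1] x [1/3, 1], and its swap on [1/3, 1] x [0, 1]. *)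
Lemma cross_entropy_weights (R : realType) (c x y : R) :
  2414 / 1000 <= c -> 0 <= x <= 1 -> 0 <= y <= 1 ->
  exists pq : R * R, [/\ 0 < pq.1 < 1, 0 < pq.2 < 1 &
    (1 - y) * - (x * ln pq.1 + (1 - x) * ln (1 - pq.1)) +
    (1 - x) * - (y * ln pq.2 + (1 - y) * ln (1 - pq.2))
      <= ln c].
Proof.
move=> c_ge.
have c0 : 0 < c by lra.
(* The corner checks below are rational inequalities in [c], [c ^+ 3] and [c ^+ 9]. The most
   demanding cubic one is [E0] of [strip], which asks for [c ^+ 3 >= 16807 / 1200], slightly above
   14. *)
have c3_ge : 1406 / 100 <= c ^+ 3.
  have : (2414 / 1000) ^+ 3 <= c ^+ 3 by rewrite lerXn2r ?nnegrE //; lra.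
  by apply: le_trans; lra.
have c9_ge : 2744 <= c ^+ 9.
  have -> : c ^+ 9 = (c ^+ 3) ^+ 3 by rewrite -exprM.
  have : 14 ^+ 3 <= (c ^+ 3) ^+ 3 by rewrite lerXn2r ?nnegrE //; lra.
  by apply: le_trans; lra.
have wsum_ge0 (s t u v : R) :
    0 <= s -> 0 <= t -> 0 <= u -> 0 <= v -> 0 <= s * u + t * v.
  by move=> s0 t0 u0 v0; rewrite addr_ge0 ?mulr_ge0.
have strip x' y' : 0 <= x' <= 1 -> 3^-1 <= y' <= 1 ->
    (1 - y') * - (x' * ln (2 / 7) + (1 - x') * ln (1 - 2 / 7)) +
    (1 - x') * - (y' * ln (3 / 7) + (1 - y') * ln (1 - 3 / 7)) <= ln c.
  have -> : 1 - 2 / 7 = 5 / 7 :> R by field.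
  have -> : 1 - 3 / 7 = 4 / 7 :> R by field.
  move=> /andP[x0 x1] /andP[y0 y1].
  (* [E11] and [E01] are the slacks at the corners (1, 1) and (0, 1); [E1] and [E0] are three times
     those at (1, 1/3) and (0, 1/3), which makes the coefficients of the logarithms integers. *)
  have E11 : 0 <= ln c by apply: ln_ge0; lra.
  have E01 : 0 <= ln (3 / 7) + ln c.
    by rewrite -lnM ?posrE ?ln_ge0 ?(mulr_gt0, invr_gt0, ltr0n) //; lra.
  have E1 : 0 <= ln (2 / 7) *+ 2 + ln c *+ 3.
    by rewrite -!lnXn -?lnM ?posrE ?ln_ge0
      ?(mulr_gt0, exprn_gt0, invr_gt0, ltr0n) //; lra.
  have E0 : 0 <= ln (5 / 7) *+ 2 + ln (4 / 7) *+ 2 + ln (3 / 7) + ln c *+ 3.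
    by rewrite -!lnXn -?lnM ?posrE ?ln_ge0
      ?(mulr_gt0, exprn_gt0, invr_gt0, ltr0n) //; lra.
  rewrite -subr_ge0.
  set l := ln c in E11 E01 E1 E0 *; set l2 := ln (2 / 7) in E1 *.
  set l3 := ln (3 / 7) in E01 E0 *; set l4 := ln (4 / 7) in E0 *.
  set l5 := ln (5 / 7) in E0 *.
  (* Bilinear interpolation of the slack from the four corners, with nonnegative coefficients on the
     strip. *)
  have -> : l - ((1 - y') * - (x' * l2 + (1 - x') * l5) +
      (1 - x') * - (y' * l3 + (1 - y') * l4))
    = (1 - x') * ((1 - y') / 2 * (l5 *+ 2 + l4 *+ 2 + l3 + l *+ 3)
                  + (3 * y' - 1) / 2 * (l3 + l))
      + x' * ((1 - y') / 2 * (l2 *+ 2 + l *+ 3) + (3 * y' - 1) / 2 * l).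
    by field.
  have y1' : 0 <= (1 - y') / 2 by lra.
  have y0' : 0 <= (3 * y' - 1) / 2 by lra.
  by rewrite !wsum_ge0 // subr_ge0.
move=> x01 y01.
have [y3|y3] := lerP 3^-1 y.
  exists (2 / 7, 3 / 7); split => /=; [lra|lra|].
  by apply: strip => //; case/andP: y01 => _ ->; rewrite y3.
have [x3|x3] := lerP 3^-1 x.
  exists (3 / 7, 2 / 7); split => /=; [lra|lra|].
  by rewrite addrC; apply: strip => //; case/andP: x01 => _ ->; rewrite x3.
exists (3 / 10, 3 / 10); split => /=; [lra|lra|].
have -> : 1 - 3 / 10 = 7 / 10 :> R by field.
(* The slack at (0, 0), three times that at (0, 1/3) and, by symmetry, (1/3, 0), and nine times that
   at (1/3, 1/3); the slack is then interpolated from these. *)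
have E00 : 0 <= ln (7 / 10) *+ 2 + ln c.
  by rewrite -!lnXn -?lnM ?posrE ?ln_ge0
      ?(mulr_gt0, exprn_gt0, invr_gt0, ltr0n) //; lra.
have E01 : 0 <= ln (7 / 10) *+ 4 + ln (3 / 10) + ln c *+ 3.
  by rewrite -!lnXn -?lnM ?posrE ?ln_ge0
      ?(mulr_gt0, exprn_gt0, invr_gt0, ltr0n) //; lra.
have E11 : 0 <= ln (7 / 10) *+ 8 + ln (3 / 10) *+ 4 + ln c *+ 9.
  by rewrite -!lnXn -?lnM ?posrE ?ln_ge0
      ?(mulr_gt0, exprn_gt0, invr_gt0, ltr0n) //; lra.
rewrite -subr_ge0.
set l := ln c in E00 E01 E11 *; set l7 := ln (7 / 10) in E00 E01 E11 *.
set l3 := ln (3 / 10) in E01 E11 *.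
have -> : l - ((1 - y) * - (x * l3 + (1 - x) * l7) +
    (1 - x) * - (y * l3 + (1 - y) * l7))
  = (1 - 3 * x) * (1 - 3 * y) * (l7 *+ 2 + l)
    + ((1 - 3 * x) * y + x * (1 - 3 * y)) * (l7 *+ 4 + l3 + l *+ 3)
    + x * y * (l7 *+ 8 + l3 *+ 4 + l *+ 9).
  by field.
move/andP: x01 => [x0 x1]; move/andP: y01 => [y0 y1].
have x3' : 0 <= 1 - 3 * x by lra.
have y3' : 0 <= 1 - 3 * y by lra.
apply: addr_ge0; last by rewrite !mulr_ge0.
apply: wsum_ge0 => //; first exact: mulr_ge0.
by apply: addr_ge0; apply: mulr_ge0.
Qed.

Theorem theorem1 (R : realType) (n : nat) (T : finType) (A B : {set {set T}}) :
  #|T| = n ->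
  recovering_pair A B ->
  (#|A| * #|B|)%:R <= (1 + Num.sqrt 2) ^+ n :> R.
Proof.
move=> cardT recAB.
have c0 : 0 < 1 + Num.sqrt 2 :> R by rewrite ltr_pwDl ?sqrtr_ge0.
have [->|A0] := eqVneq A set0; first by rewrite cards0 mul0n exprn_ge0 ?ltW.
have [->|B0] := eqVneq B set0; first by rewrite cards0 muln0 exprn_ge0 ?ltW.
have injA Y : Y \in B -> {in A &, injective (fun X => X :\: Y)}.
  by move=> YB X X' XA X'A /=; apply: (recAB X X' Y Y XA X'A YB YB).1.
have injB X : X \in A -> {in B &, injective (fun Y => Y :\: X)}.
  by move=> XA Y Y' YB Y'B /=; apply: (recAB X X Y Y' XA XA YB Y'B).2.
have c_ge : 2414 / 1000 <= 1 + Num.sqrt 2 :> R.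
  suff : 1414 / 1000 <= Num.sqrt 2 :> R by lra.
  by rewrite -[leLHS]ger0_norm -?sqrtr_sqr ?ler_wsqrtr //; lra.
(* The weights are chosen separately for each [i], according to its two frequencies. *)
have [w wP] := boolp.choice (fun i =>
  cross_entropy_weights c_ge (freq_ge0_le1 R A i) (freq_ge0_le1 R B i)).
have p01 i : 0 < (w i).1 < 1 by case: (wP i).
have q01 i : 0 < (w i).2 < 1 by case: (wP i).
have hA := ln_card_le_cross_entropy A0 B0 injA p01.
have hB := ln_card_le_cross_entropy B0 A0 injB q01.
have nA : 0 < #|A|%:R :> R by rewrite ltr0n card_gt0.
have nB : 0 < #|B|%:R :> R by rewrite ltr0n card_gt0.
(* After taking logarithms, the right side is a sum of [n] equal terms over the ground set, so the
   comparison is made point by point. *)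
rewrite natrM -ler_ln ?posrE ?mulr_gt0 ?exprn_gt0 // lnM ?posrE // lnXn //.
apply: (le_trans (lerD hA hB)); rewrite -big_split /= -cardT -sumr_const.
by apply: ler_sum => i _; case: (wP i).
Qed.
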